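(* Let $k\geq 3$ and let $\Delta_k$ be the marked group $\mathbb{Z}/k\mathbb{Z}\rtimes_{\varphi_k}\mathbb{Z}$, where $\varphi_k:\mathbb{Z}\to\mathrm{Aut}(\mathbb{Z}/k\mathbb{Z})$ sends $1$ to the inversion map (so the product is $(a,m)(b,n)=(a+(-1)^m b,m+n)$), with generating set consisting of the elements $(i,0)$ for $i\neq 0$, $(i,1)$ for $i\notin\{0,1\}$, and $(i,-1)$ for $i\notin\{0,1\}$ (where $i$ ranges over $\mathbb{Z}/k\mathbb{Z}$). Then $\chi_B(F(2^{\Delta_k}))=k+1$.
   Context: A marked group is a finitely generated group $\Gamma$ with a finite symmetric generating set $S$ not containing the identity. The left shift action of $\Gamma$ on $2^\Gamma$ is $(g\cdot x)(h)=x(g^{-1}h)$; its free part is $F(2^\Gamma)=\{x\in 2^\Gamma : g\cdot x\neq x \text{ for all } g\neq \mathrm{id}\}$. The shift graph $F(2^\Gamma)$ is the graph on this free part joining distinct $x,y$ iff $s\cdot x=y$ for some $s\in S$. $\chi_B(G)$ denotes the Borel chromatic number: the least $k$ such that there is a Borel map $c$ from the vertex set to a $k$-element set with $c(x)\neq c(y)$ for adjacent $x,y$. *)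

(* Defs.v *)
From HB Require Import structures.
From mathcomp Require Import all_boot all_order all_algebra.
From mathcomp Require Import all_classical all_reals all_analysis.

Set Implicit Arguments.
Unset Strict Implicit.
Unset Printing Implicit Defensive.

Import GRing.Theory.

Local Open Scope classical_set_scope.

Record is_marking (G : groupType) (S : set G) : Prop := IsMarking {
  marking_finite : finite_set S;
  marking_symmetric : forall s : G, S s -> S s^-1%g;
  marking_not1 : ~ S 1%g;
  marking_generates : forall H : set G,
    H 1%g -> (forall g h : G, H g -> H h -> H (g * h)%g) ->
    (forall g : G, H g -> H g^-1%g) -> S `<=` H -> H = setT
}.

(* 2^G with the product topology, the topology on bool being discrete. *)
Definition shift_space (G : groupType) : topologicalType :=
  prod_topology (fun _ : G => bool).

Definition shift_act (G : groupType) (g : G) (x : shift_space G) :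
    shift_space G :=
  fun h : G => x (g^-1 * h)%g.

Definition free_part (G : groupType) : set (shift_space G) :=
  [set x | forall g : G, g <> 1%g -> shift_act g x <> x].

(* The vertices are the elements of the set_type of free_part G, whose
   canonical topology is the subspace topology inherited from 2^G. *)
Definition shift_graph (G : groupType) (S : set G)
    (x y : set_type (@free_part G)) : Prop :=
  x <> y /\ exists2 s : G, S s & shift_act s (set_val x) = set_val y.

Definition borel_set (T : topologicalType) : set (set T) :=
  <<s [set U : set T | open U] >>.

(* All subsets of the finite set of colours 'I_n are Borel. *)
Definition borel_colorable (T : topologicalType) (E : T -> T -> Prop)
    (n : nat) : Prop :=
  exists c : T -> 'I_n,
    (forall B : set 'I_n, borel_set (c @^-1` B)) /\
    (forall x y : T, E x y -> c x <> c y).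

Definition is_borel_chromatic_number (T : topologicalType)
    (E : T -> T -> Prop) (n : nat) : Prop :=
  borel_colorable E n /\ forall m : nat, borel_colorable E m -> (n <= m)%N.

(* Carrier of the semidirect product of Z/k by Z. For k < 2 the type 'Z_k is
   Z/2, so Delta k is the intended group only when k >= 2. *)
Definition Delta (k : nat) : Type := ('Z_k * int)%type.

HB.instance Definition _ (k : nat) := Choice.on (Delta k).

Section DeltaGroup.
Variable k : nat.
Local Open Scope ring_scope.
Implicit Types x y z : Delta k.

Definition Delta_one : Delta k := (0, 0).

Definition Delta_mul x y : Delta k := (x.1 + (-1) ^ x.2 * y.1, x.2 + y.2).

Definition Delta_inv x : Delta k := (- ((-1) ^ (- x.2) * x.1), - x.2).

Let m1unit : (-1 : 'Z_k) \is a GRing.unit.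
Proof. by rewrite unitrN unitr1. Qed.

Fact Delta_mulA : associative Delta_mul.
Proof.
move=> x y z; rewrite /Delta_mul /=; congr pair; last by rewrite addrA.
by rewrite mulrDr addrA exprzDr // mulrA.
Qed.

Fact Delta_mul1 : left_id Delta_one Delta_mul.
Proof. by case=> a m; rewrite /Delta_mul /= expr0z mul1r !add0r. Qed.

Fact Delta_mulr1 : right_id Delta_one Delta_mul.
Proof. by case=> a m; rewrite /Delta_mul /= mulr0 !addr0. Qed.

Fact Delta_mulV : left_inverse Delta_one Delta_inv Delta_mul.
Proof. by case=> a m; rewrite /Delta_mul /Delta_inv /= !addNr. Qed.

Fact Delta_mulrV : right_inverse Delta_one Delta_inv Delta_mul.
Proof.
case=> a m; rewrite /Delta_mul /Delta_inv /= mulrN mulrA -exprzDr //.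
by rewrite !subrr expr0z mul1r subrr.
Qed.

HB.instance Definition _ := isGroup.Build (Delta k)
  Delta_mulA Delta_mul1 Delta_mulr1 Delta_mulV Delta_mulrV.

Definition Delta_gens : set (Delta k) :=
  [set x : Delta k | [\/ x.1 <> 0 /\ x.2 = 0,
                         [/\ x.1 <> 0, x.1 <> 1 & x.2 = 1]
                       | [/\ x.1 <> 0, x.1 <> 1 & x.2 = -1]]].

End DeltaGroup.

Section DeltaMarking.
Variable k : nat.
Hypothesis k_ge3 : (3 <= k)%N.
Local Open Scope ring_scope.

Lemma Delta_marking : is_marking (@Delta_gens k).
Proof.
split.
- pose l : seq (Delta k) :=
    [seq ((i, z) : 'Z_k * int) | i <- enum 'Z_k, z <- [:: 0; 1; -1]].
  apply: (@sub_finite_set _ _ [set` l]); last exact: finite_seq.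
  move=> [i z] /= h; apply/allpairsP; exists (i, z) => /=.
  rewrite mem_enum; split=> //.
  by case: h => /= [[_ ->]|[_ _ ->]|[_ _ ->]]; rewrite !inE eqxx ?orbT.
- move=> [i z]; change (Delta_gens ((i, z) : Delta k) ->
    Delta_gens (Delta_inv ((i, z) : Delta k))).
  rewrite /Delta_gens /Delta_inv /=; case=> [[i0 ->]|[i0 i1 ->]|[i0 i1 ->]].
  + constructor 1; rewrite oppr0 expr0z mul1r; split=> // /eqP.
    by rewrite oppr_eq0 => /eqP.
  + by constructor 3; rewrite exprN1 invrN1 mulN1r opprK.
  + by constructor 2; rewrite opprK expr1z mulN1r opprK.
- rewrite /Delta_gens /= => -[[]|[]|[]]; by [].
- move=> H H1 HM HV HS.
  have {}HM (x y : Delta k) : H x -> H y -> H (Delta_mul x y) by exact: HM.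
  have {}HV (x : Delta k) : H x -> H (Delta_inv x) by exact: HV.
  apply/seteqP; split=> // -[i z] _.
  have Hi (j : 'Z_k) : H ((j, 0) : Delta k).
    have [->|/eqP j0] := eqVneq j 0; first exact: H1.
    by apply: HS; constructor 1.
  have Hm1 : H ((-1, 1) : Delta k).
    apply: HS; constructor 2; split=> //=.
      by apply/eqP; rewrite oppr_eq0 oner_neq0.
    move=> /eqP; rewrite -subr_eq0 -opprD oppr_eq0 => /eqP/(congr1 val).
    by case: k k_ge3 => [|[|[|k']]].
  have Hj (j : 'Z_k) : H ((j, 1) : Delta k).
    suff -> : (j, 1) = Delta_mul (j + 1, 0) (-1, 1) by exact: HM.
    by rewrite /Delta_mul /= expr0z mul1r addrK add0r.
  have Hn (n : nat) : H ((0, n%:Z) : Delta k).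
    elim: n => [|n IH]; first exact: H1.
    suff -> : (0, n.+1%:Z) = Delta_mul ((0, n%:Z) : Delta k) (0, 1).
      exact: HM.
    by rewrite /Delta_mul /= mulr0 addr0 -PoszD addn1.
  have Hz (w : int) : H ((0, w) : Delta k).
    case: w => n; first exact: Hn.
    by have /HV := Hn n.+1; rewrite /Delta_inv /= mulr0 oppr0 NegzE.
  suff -> : (i, z) = Delta_mul (i, 0) (0, z) by exact: HM.
  by rewrite /Delta_mul /= mulr0 addr0 add0r.
Qed.

End DeltaMarking.

(* Main.v *)
Require Import Defs.
From mathcomp Require Import all_boot all_order all_algebra all_fingroup.
From mathcomp Require Import all_classical all_reals all_analysis.
From mathcomp Require Import zify ring.

(** The layer [{(a, m) | a in Z/k}] is a [k]-clique, and [(a, m)] is joined to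
    every [(b, m + 1)] except [b = - a] and [b = 1 - a].

    Lower bound. A [k]-colouring is a bijection on each layer, and two
    consecutive layers carry the same colours up to a reflection
    [a |-> d - a] with [d] constant.  Hence the cyclic orientation induced on
    the colours by [Z/k] flips at every step.  Colour classes have the Baire
    property, so along the orbit of a generic point they are open, and a
    generic point returns arbitrarily close to itself after an odd number of
    steps: some odd layer is coloured like layer [0], a contradiction.

    Upper bound. With one spare colour, a layer may be recoloured one vertex at
    a time, following the lines [(a, m), (- a, m + 1), ...].  These moves are
    the transpositions with a fixed point (the unused colour), so they connect
    any two colourings of a layer in every sufficiently large number of steps.
    A Borel maximal set of sparse markers fixes the colouring on the layers it
    meets, and the gaps are filled by such paths. *)

Set Implicit Arguments.
Unset Strict Implicit.
Unset Printing Implicit Defensive.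

Local Open Scope classical_set_scope.

(** * Borel sets and the free part of the shift *)

Section BorelClosure.
Variable T : topologicalType.

Lemma borel_not (P : T -> Prop) :
  borel_set [set x | P x] -> borel_set [set x | ~ P x].
Proof.
by move=> /(@sigma_algebraCD _ setT); rewrite setTD.
Qed.

Lemma borel_exists (I : countType) (P : I -> T -> Prop) :
  (forall i, borel_set [set x | P i x]) -> borel_set [set x | exists i, P i x].
Proof.
move=> bP; pose A n := if unpickle n is Some i then [set x | P i x] else set0.
have -> : [set x | exists i, P i x] = \bigcup_n A n.
  apply/seteqP; split=> x /=.
    by case=> i Pi; exists (pickle i) => //; rewrite /A pickleK.
  by case=> n _; rewrite /A; case: unpickle => // i Pi; exists i.
apply: sigma_algebra_bigcup => n; rewrite /A.
by case: unpickle => [i|]; [exact: bP|exact: sigma_algebra0].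
Qed.

Lemma borel_forall (I : countType) (P : I -> T -> Prop) :
  (forall i, borel_set [set x | P i x]) -> borel_set [set x | forall i, P i x].
Proof.
move=> bP; rewrite (_ : [set x | _] = [set x | ~ exists i, ~ P i x]).
  by apply: borel_not; apply: borel_exists => i; exact: borel_not.
apply/seteqP; split=> x /=; first by move=> Px [i].
by move=> + i; apply: contra_notP; exists i.
Qed.

Lemma borel_and (P Q : T -> Prop) :
  borel_set [set x | P x] -> borel_set [set x | Q x] ->
  borel_set [set x | P x /\ Q x].
Proof.
move=> bP bQ.
rewrite (_ : [set x | _] = [set x | forall b : bool, if b then P x else Q x]).
  by apply: borel_forall => -[].
apply/seteqP; split=> x /=; first by case=> ? ? -[].
by move=> H; split; [exact: (H true)|exact: (H false)].
Qed.

Lemma borel_or (P Q : T -> Prop) :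
  borel_set [set x | P x] -> borel_set [set x | Q x] ->
  borel_set [set x | P x \/ Q x].
Proof.
move=> bP bQ.
rewrite (_ : [set x | _] = [set x | exists b : bool, if b then P x else Q x]).
  by apply: borel_exists => -[].
apply/seteqP; split=> x /=; last by case=> -[]; [left|right].
by case=> H; [exists true|exists false].
Qed.

Lemma borel_cst (P : Prop) : borel_set [set _ : T | P].
Proof.
have b0 : borel_set (set0 : set T) by exact: sigma_algebra0.
have [p|np] := pselect P.
  rewrite (_ : [set _ | _] = [set x | ~ set0 x]); first exact: borel_not.
  by apply/seteqP; split=> x // _ [].
by rewrite (_ : [set _ | _] = set0) //; apply/seteqP; split=> x.
Qed.

Lemma borel_imply (P : Prop) (Q : T -> Prop) :
  borel_set [set x | Q x] -> borel_set [set x | P -> Q x].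
Proof.
move=> bQ; have [p|np] := pselect P.
  rewrite (_ : [set x | _] = [set x | Q x]) //.
  by apply/seteqP; split=> x //=; exact.
rewrite (_ : [set x | _] = [set _ | True]); first exact: borel_cst.
by apply/seteqP; split=> x // _ /np.
Qed.

End BorelClosure.

Section Shift.
Variable G : groupType.
Implicit Types (g h : G) (x y : shift_space G).

Lemma shift_actM g h x : shift_act (g * h)%g x = shift_act g (shift_act h x).
Proof. by apply/funext => f; rewrite /shift_act invgM mulgA. Qed.

Lemma shift_act1 x : shift_act 1%g x = x.
Proof. by apply/funext => f; rewrite /shift_act invg1 mul1g. Qed.

Lemma free_part_act g x : free_part x -> free_part (shift_act g x).
Proof.
move=> Fx h h1; rewrite -shift_actM => /(congr1 (shift_act g^-1%g)).
rewrite -!shift_actM mulVg shift_act1; apply: Fx => e; apply: h1.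
apply: (@mulIg _ g); apply: (@mulgI _ g^-1%g).
by rewrite mul1g mulVg -e.
Qed.

Notation X := (set_type (@free_part G)).

Lemma free_val (x : X) : free_part (set_val x).
Proof. exact: set_mem (valP x). Qed.

Definition act g (x : X) : X :=
  SigSub (mem_set (@free_part_act g _ (@free_val x))).

Lemma actM g h (x : X) : act (g * h)%g x = act g (act h x).
Proof. by apply: val_inj => /=; rewrite shift_actM. Qed.

Lemma act1 (x : X) : act 1%g x = x.
Proof. by apply: val_inj => /=; rewrite shift_act1. Qed.

Lemma act_free g (x : X) : act g x = x -> g = 1%g.
Proof.
move=> /(congr1 set_val) e; apply: contrapT => g1.
exact: (@free_val x _ g1 e).
Qed.

Lemma shift_graph_act (S : set G) (x y : X) :
  shift_graph S x y -> exists2 s, S s & y = act s x.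
Proof. by move=> [_ [s Ss e]]; exists s => //; apply: val_inj. Qed.

Lemma act_shift_graph (S : set G) s (x : X) :
  ~ S 1%g -> S s -> shift_graph S x (act s x).
Proof.
move=> S1 Ss; split; last by exists s.
by move=> e; apply: S1; rewrite -(@act_free s x).
Qed.

Lemma borel_coord h (b : bool) : borel_set [set x : X | set_val x h = b].
Proof.
apply: sub_sigma_algebra => /=.
exists [set x : shift_space G | x h = b] => //.
rewrite (_ : [set x | _] = (fun x : shift_space G => x h) @^-1` [set b]) //.
apply: open_comp; last exact: discrete_open.
by move=> x _; exact: (@proj_continuous G (fun=> bool) h x).
Qed.

Definition agree (s : seq G) x y := forall h, h \in s -> x h = y h.

(** The filter generated by the cylinders at [x] converges to [x] in every coordinate, hence in the
    product topology. *)
Lemma open_agree (U : set (shift_space G)) x :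
  open U -> U x -> exists s, agree s x `<=` U.
Proof.
move=> oU Ux; pose F := filter_from [set: seq G] (fun s => agree s x).
have FF : Filter F.
  apply: filter_from_filter; first by exists [::].
  move=> s t _ _; exists (s ++ t) => // y xy.
  by split=> h hs; apply: xy; rewrite mem_cat hs ?orbT.
have cF : F --> x.
  apply/cvg_sup => h V [W [[B oB <-] Bx BV]].
  exists [:: h] => // y xy; apply: BV => /=.
  by rewrite -(xy h) // mem_head.
have [s _ sU] : F U by apply: cF; exact: open_nbhs_nbhs.
by exists s.
Qed.

Lemma open_free_agree (U : set X) (x : X) :
  open U -> U x ->
  exists s, forall y : X, agree s (set_val x) (set_val y) -> U y.
Proof.
move=> [V oV <-] Vx; have [s sV] := open_agree oV Vx.
by exists s => y; exact: sV.
Qed.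

End Shift.

(** * Borel maximal independent sets *)

Section MaximalIndependentSet.
Variables (G : groupType) (e : nat -> G) (W : seq G).
Hypothesis e_surj : forall g, exists n, e n = g.
Hypothesis W1 : 1%g \in W.
Hypothesis WV : forall g, g \in W -> g^-1%g \in W.
Notation X := (set_type (@free_part G)).

(** Naming coordinates by [nat] through [e] puts the cylinders in a countable type, so that [pickle]
    enumerates them. *)
Definition code_cyl (p : seq (nat * bool)) (x : X) : Prop :=
  all (fun q => set_val x (e q.1) == q.2) p.

Definition separating (p : seq (nat * bool)) : Prop :=
  forall y g, g \in W -> g <> 1%g -> code_cyl p y -> ~ code_cyl p (act g y).

Lemma code_cyl_cat p q x :
  code_cyl (p ++ q) x <-> code_cyl p x /\ code_cyl q x.
Proof. by rewrite /code_cyl all_cat; split=> [/andP|[-> ->]]. Qed.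

Lemma borel_code_cyl p g : borel_set [set x | code_cyl p (act g x)].
Proof.
elim: p => [|q p IH]; first exact: (@borel_cst _ (is_true true)).
rewrite (_ : [set x | _] =
  [set x : X | set_val x (g^-1 * e q.1)%g = q.2 /\ code_cyl p (act g x)]).
  by apply: borel_and => //; exact: (@borel_coord _ (g^-1 * e q.1)%g q.2).
apply/seteqP; split=> x; rewrite /code_cyl /=; first by case/andP => /eqP.
by case=> /eqP -> ->.
Qed.

(** By freeness each [g <> 1] in [W] changes some coordinate [h] of [x]. Prescribing the values at
    [h] and [g^-1 * h] keeps [y] and [act g y] from sharing the cylinder. *)
Lemma separating_cover x : exists2 p, separating p & code_cyl p x.
Proof.
suff [p px pW] : exists2 p, code_cyl p x & forall g, g \in W -> g <> 1%g ->
    forall y, code_cyl p y -> ~ code_cyl p (act g y).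
  by exists p => // y g gW g1; exact: pW.
elim: W => [|g s [p px ps]]; first by exists [::].
have [->|/eqP g1] := eqVneq g 1%g.
  exists p => // h; rewrite inE => /orP[/eqP-> //|hs h1]; exact: ps.
have [h xh] : exists h, set_val x (g^-1 * h)%g <> set_val x h.
  apply: contrapT => /forallNP H; apply: (@free_val _ x _ g1).
  by apply/funext => h; exact: contrapT (H h).
have [[n en] [m em]] := (e_surj h, e_surj (g^-1 * h)%g).
exists ([:: (n, set_val x h); (m, set_val x (g^-1 * h)%g)] ++ p).
  by apply/code_cyl_cat; split=> //; rewrite /code_cyl /= en em !eqxx.
move=> f; rewrite inE => /orP[/eqP->|fs] f1 y /code_cyl_cat[y1 y2]
  /code_cyl_cat[z1 z2]; last exact: (ps f fs f1 y).
move: y1 z1; rewrite /code_cyl /= en em => /and3P[_ /eqP y1 _].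
by move=> /and3P[/eqP z1 _ _]; apply: xh; rewrite -y1 -z1.
Qed.

Definition nth_cyl n (x : X) : Prop :=
  if unpickle n is Some p then separating p /\ code_cyl p x else False.

(** Stage [m] adds the points of the [m]-th separating cylinder that have no [W]-translate so far;
    separation keeps simultaneous additions apart. Indexing [W] by [nat] makes the condition a
    countable intersection. *)
Fixpoint greedy n : X -> Prop :=
  if n is m.+1 then fun x => greedy m x \/
    (nth_cyl m x /\ forall i, (i < size W)%N -> ~ greedy m (act (nth 1%g W i) x))
  else fun _ => False.

Lemma borel_greedy n g : borel_set [set x | greedy n (act g x)].
Proof.
elim: n g => [|n IH] g; first exact: (@borel_cst _ False).
apply: borel_or; first exact: IH.
apply: borel_and.
  rewrite /nth_cyl; case: unpickle => [p|]; last exact: borel_cst.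
  by apply: borel_and; [exact: borel_cst|exact: borel_code_cyl].
apply: borel_forall => i; apply: borel_imply; apply: borel_not.
under eq_fun do rewrite -actM; exact: IH.
Qed.

Lemma greedy_mono m n x : (m <= n)%N -> greedy m x -> greedy n x.
Proof.
move=> /subnKC <-; elim: (n - m)%N => [|d IH]; first by rewrite addn0.
by rewrite addnS => /IH; left.
Qed.

Lemma greedy_added n x : greedy n x -> exists m, nth_cyl m x /\
  greedy m.+1 x /\ forall g, g \in W -> ~ greedy m (act g x).
Proof.
elim: n => // n IH [/IH //|[Vx Wx]]; exists n; split=> //; split; first by right.
by move=> g gW; rewrite -(nth_index 1%g gW); apply: Wx; rewrite index_mem.
Qed.

(** Of two conflicting points, the later to enter would have been blocked by the earlier, through
    [g] or its inverse. At the stage of a separating cylinder around [x], either a [W]-translate is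
    already present or [x] enters. *)
Lemma borel_maximal_independent : exists M : X -> Prop,
  [/\ forall g, borel_set [set x | M (act g x)],
      forall x g, g \in W -> M x -> M (act g x) -> g = 1%g &
      forall x, exists2 g, g \in W & M (act g x)].
Proof.
exists (fun x => exists n, greedy n x); split.
- by move=> g; apply: borel_exists => n; exact: borel_greedy.
- move=> x g gW [n /greedy_added [i [Vi [ix ni]]]].
  move=> [n' /greedy_added [j [Vj [jx nj]]]].
  case: (ltngtP i j) => ij.
  + case: (nj g^-1%g (WV gW)); rewrite -actM mulVg act1.
    exact: greedy_mono ix.
  + by case: (ni g gW); exact: greedy_mono jx.
  + move: Vi Vj; rewrite ij /nth_cyl; case: unpickle => // p [sp px] [_ pgx].
    by apply: contrapT => g1; exact: sp px pgx.
- move=> x; have [p sp px] := separating_cover x.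
  have [[g gW Mg]|nM] :=
    pselect (exists2 g, g \in W & greedy (pickle p) (act g x)).
    by exists g => //; exists (pickle p).
  exists 1%g => //; exists (pickle p).+1; rewrite act1; right.
  split; first by rewrite /nth_cyl pickleK.
  by move=> i iW Mi; apply: nM; exists (nth 1%g W i) => //; exact: mem_nth.
Qed.

End MaximalIndependentSet.

(** * Baire category in the shift space *)

Section Category.
Variable G : groupType.
Implicit Types (U P : set (shift_space G)).
Notation X := (set_type (@free_part G)).

Definition cyl_open U := forall x, U x -> exists s, agree s x `<=` U.

Definition cyl_dense U := forall s x, exists2 y, agree s x y & U y.

Definition residual P := exists2 D : nat -> set (shift_space G),
  forall n, cyl_open (D n) /\ cyl_dense (D n) & \bigcap_n D n `<=` P.

Lemma residual_open_dense U : cyl_open U -> cyl_dense U -> residual U.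
Proof.
by move=> oU dU; exists (fun _ => U) => // x; exact: (fun Ux => Ux 0%N I).
Qed.

Lemma residualT : residual setT.
Proof.
by apply: residual_open_dense => [x _|s x]; [exists [::]|exists x].
Qed.

Lemma residual_sub P Q : P `<=` Q -> residual P -> residual Q.
Proof. by move=> PQ [D oD DP]; exists D => // x /DP/PQ. Qed.

Lemma residual_forall (I : countType) (P : I -> set (shift_space G)) :
  (forall i, residual (P i)) -> residual [set x | forall i, P i x].
Proof.
move=> rP; have /choice[D DP] : forall i, exists D : nat -> set (shift_space G),
    (forall n, cyl_open (D n) /\ cyl_dense (D n)) /\ \bigcap_n D n `<=` P i.
  by move=> i; have [D] := rP i; exists D.
exists (fun n => if unpickle n is Some (i, m) then D i m else setT).
  move=> n; case: unpickle => [[i m]|]; first exact: (DP i).1.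
  split=> [x _|s x]; first by exists [::].
  by exists x.
move=> x Dx i; apply: (DP i).2 => n _.
by have := Dx (pickle (i, n)) Logic.I; rewrite pickleK.
Qed.

Lemma residual_act g P : residual P -> residual [set x | P (shift_act g x)].
Proof.
move=> [D oD DP]; exists (fun n x => D n (shift_act g x)); last first.
  by move=> x Dx; apply: DP => n _; exact: Dx.
move=> n; have [oDn dDn] := oD n; split.
  move=> x /oDn[s sD]; exists [seq (g^-1 * h)%g | h <- s] => y xy.
  by apply: sD => h hs; apply: xy; exact: map_f.
move=> s x; have [y xy Dy] := dDn [seq (g * h)%g | h <- s] (shift_act g x).
exists (shift_act g^-1%g y); last by rewrite -shift_actM mulgV shift_act1.
by move=> h hs; rewrite /shift_act invgK -xy ?map_f // /shift_act mulKg.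
Qed.

(** Baire category: cylinders are shrunk successively into the dense open sets, and their finite
    patterns are glued. *)
Lemma residual_nonempty P : residual P -> P !=set0.
Proof.
move=> [D oD DP].
have /choice[f fP] : forall c : nat * (seq G * shift_space G),
    exists d : seq G * shift_space G,
    [/\ {subset c.2.1 <= d.1}, agree c.2.1 c.2.2 d.2 &
        agree d.1 d.2 `<=` D c.1].
  move=> [n [s x]] /=; have [oDn dDn] := oD n.
  have [y xy /oDn[t tD]] := dDn s x.
  exists (s ++ t, y); split=> //= [h hs|z yz].
    by rewrite mem_cat hs.
  by apply: tD => h ht; apply: yz; rewrite mem_cat ht orbT.
pose c := fix c n := if n is m.+1 then f (m, c m) else ([::], fun=> false).
have cP m n : (m <= n)%N ->
    {subset (c m).1 <= (c n).1} /\ agree (c m).1 (c m).2 (c n).2.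
  move=> /subnKC <-; elim: (n - m)%N => [|d [IH1 IH2]].
    by rewrite addn0; split.
  rewrite addnS; have [/= f1 f2 _] := fP ((m + d)%N, c (m + d)%N).
  split=> [h /IH1/f1 //|h hm].
  by rewrite IH2 //; exact: f2 (IH1 _ hm).
(* Coordinates never decided along the sequence get the default value [false]. *)
pose z : shift_space G := fun g =>
  if pselect (exists n, g \in (c n).1) is left ex
  then (c (projT1 (cid ex))).2 g else false.
have zP n : agree (c n).1 (c n).2 z.
  move=> g gn; rewrite /z; case: pselect => [ex|[]]; last by exists n.
  case: cid => /= m gm; have [/cP[_]|/cP[_]] := orP (leq_total n m).
    exact.
  by move=> ->.
exists z; apply: DP => n _; have [_ _] := fP (n, c n); apply.
exact: (zP n.+1).
Qed.

(** [U] lives in the whole shift space, where the category argument takes place; the equivalence is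
    vacuous off the free part. *)
Definition baire_property (A : set X) := exists2 U, cyl_open U &
  residual [set x | forall z : X, set_val z = x -> (A z <-> U x)].

Lemma baire_property_sigma_algebra : sigma_algebra setT baire_property.
Proof.
split.
- by exists set0 => //; apply: residual_sub residualT => x _ z _.
- move=> A [U oU rU].
  (* [V] is the interior of the complement of [U]; the two together miss only the nowhere dense
     boundary of [U]. *)
  pose V : set (shift_space G) := fun x => exists s, agree s x `<=` ~` U.
  have oV : cyl_open V.
    move=> x [s sU]; exists s => y xy; exists s => w yw; apply: sU => h hs.
    by rewrite xy // yw.
  have rUV : residual (U `|` V).
    apply: residual_open_dense.
      move=> x [/oU|/oV] [s sx]; exists s; [left|right]; exact: sx.
    move=> s x; have [[y xy Uy]|nU] := pselect (exists2 y, agree s x y & U y).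
      by exists y => //; left.
    exists x => //; right; exists s => y xy Uy; apply: nU; by exists y.
  exists V => //.
  (* A family indexed by [bool] intersects two residual sets. *)
  have /residual_forall := fun b : bool =>
    if b return residual (if b then _ else _) then rU else rUV.
  apply: residual_sub => x H z zx.
  have := H true _ zx; have := H false => /= UV AU.
  split=> [[_ nA]|[s sV]]; first by case: UV => // /AU.
  split=> // /AU; exact: sV.
- move=> A /= rA.
  have /choice[U UP] : forall n, exists U, cyl_open U /\
      residual [set x | forall z : X, set_val z = x -> (A n z <-> U x)].
    by move=> n; have [U] := rA n; exists U.
  exists (\bigcup_n U n).
    move=> x [n _ /(UP n).1[s sU]]; exists s => y /sU; by exists n.
  have /residual_forall := fun n => (UP n).2.
  by apply: residual_sub => x H z zx; split=> -[n _ /(H n _ zx)]; exists n.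
Qed.

Lemma borel_baire_property (A : set X) : borel_set A -> baire_property A.
Proof.
move: A; apply: smallest_sub; first exact: baire_property_sigma_algebra.
move=> A oA.
pose U : set (shift_space G) := fun x => exists s,
  forall z : X, agree s x (set_val z) -> A z.
exists U.
  move=> x [s sU]; exists s => y xy; exists s => z yz; apply: sU => h hs.
  by rewrite xy // yz.
apply: residual_sub residualT => x _ z zx.
split=> [Az|[s]]; last by apply; rewrite zx.
by have [s sA] := open_free_agree oA Az; exists s; rewrite -zx.
Qed.

End Category.

(** * Freeness and recurrence of generic points *)

Section GenericPoints.
Variables (G : groupType) (e : nat -> G).
Hypothesis e_surj : forall g, exists n, e n = g.

Lemma residual_free_part : (forall s : seq G, exists g, g \notin s) ->
  residual (@free_part G).
Proof.
move=> infG.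
have fix_dense n : residual [set x | e n <> 1%g -> shift_act (e n) x <> x].
  have [g1|/eqP g1] := eqVneq (e n) 1%g.
    by apply: residual_sub (residualT _) => x _ /(_ g1).
  apply: (@residual_sub _ [set x | exists h, x ((e n)^-1 * h)%g <> x h]).
    by move=> x [h xh] _ /(congr1 (@^~ h)).
  apply: residual_open_dense.
    move=> x [h xh]; exists [:: h; ((e n)^-1 * h)%g] => y xy; exists h.
    by rewrite -!xy // !inE eqxx ?orbT.
  move=> s x; have [h hs] := infG s.
  (* As [h] is outside [s], its value is free to differ from the one at [(e n)^-1 * h], a different
     coordinate because [e n] is not the identity. *)
  exists (fun f => if f == h then ~~ x ((e n)^-1 * h)%g else x f).
    by move=> f fs; case: eqP => // fh; rewrite -fh fs in hs.
  exists h; rewrite eqxx; case: eqP => [|_]; last by case: (x _).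
  move=> /(congr1 (fun f => f * h^-1)%g); rewrite mulgK mulgV.
  by move=> /(congr1 (fun f => f^-1)%g); rewrite invgK invg1.
have := residual_forall fix_dense; apply: residual_sub => x H g.
by have [n <-] := e_surj g; exact: H.
Qed.

Lemma residual_recurrent (Q : set G) :
  (forall s : seq G, exists2 g, Q g & forall h, h \in s -> (g * h)%g \notin s) ->
  residual [set x | forall s, exists2 g, Q g & agree s x (shift_act g x)].
Proof.
move=> QP; have /choice[r re] := e_surj.
have /residual_forall : forall l : seq nat, residual
    [set x | exists2 g, Q g & agree (map e l) x (shift_act g x)].
  move=> l; apply: residual_open_dense.
    move=> x [g Qg xg]; exists (map e l ++ [seq (g^-1 * h)%g | h <- map e l]).
    move=> y xy; exists g => // h hl; rewrite -xy ?mem_cat ?hl //.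
    by rewrite xg // /shift_act xy // mem_cat orbC map_f.
  move=> s x; have [g Qg gS] := QP (s ++ map e l).
  (* With [F = s ++ map e l], the pattern of [x] on [F] is copied onto [g^-1 F], which is disjoint
     from [F]. *)
  exists (fun f => if (g * f)%g \in s ++ map e l then x (g * f)%g else x f).
    by move=> f fs; rewrite ifN // gS // mem_cat fs.
  exists g => // h hl.
  have hS : h \in s ++ map e l by rewrite mem_cat hl orbT.
  by rewrite /shift_act mulVKg hS ifN // gS.
apply: residual_sub => x H s; have [g Qg xg] := H (map r s).
by exists g => // h hs; apply: xg; rewrite -(re h); do 2!apply: map_f.
Qed.

End GenericPoints.

(** * Star transpositions and orientations of layers *)

Section StarTranspositions.
Variables (T : finType) (h : T).
Local Open Scope group_scope.

Definition star_prod (l : seq T) : {perm T} := \prod_(p <- l) tperm h p.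

(** Transpositions generate, and away from [h] the transposition of [x] and [y] is the conjugate of
    [tperm h y] by [tperm h x]. *)
Lemma star_prod_onto (s : {perm T}) : exists l, s = star_prod l.
Proof.
have star2 x y : exists l, tperm x y = star_prod l.
  have [->|xh] := eqVneq x h; first by exists [:: y]; rewrite /star_prod big_seq1.
  have [->|yh] := eqVneq y h.
    by exists [:: x]; rewrite /star_prod big_seq1 tpermC.
  have [->|xy] := eqVneq x y.
    by exists [::]; rewrite /star_prod big_nil tperm1.
  exists [:: x; y; x]; rewrite /star_prod !big_cons big_nil mulg1.
  by rewrite -{1}(tpermV h x) -conjgE tpermJ tpermL tpermD // eq_sym.
have [ts -> _] := prod_tpermP s; elim: ts => [|[x y] ts [l IH]].
  by exists [::]; rewrite /star_prod !big_nil.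
have [l' /= e] := star2 x y.
by exists (l' ++ l); rewrite big_cons /= e IH /star_prod big_cat.
Qed.

(* Padding with the trivial move [tperm h h] reaches every large length. *)
Lemma star_path : exists N, forall n (s : {perm T}), (N <= n)%N ->
  exists st : nat -> {perm T}, [/\ st 0%N = 1, st n = s &
    forall j, (j < n)%N -> exists p, st j.+1 = tperm h p * st j].
Proof.
have /choice[l lP] := star_prod_onto.
exists (\max_s size (l s)) => n s Nn.
have sn : (size (l s) <= n)%N by apply: leq_trans Nn; exact: leq_bigmax.
pose l' := nseq (n - size (l s)) h ++ l s.
have sl' : size l' = n by rewrite size_cat size_nseq subnK.
(* The last [j] factors are taken, since each move multiplies on the left. *)
exists (fun j => star_prod (drop (n - j) l')); split.
- by rewrite subn0 drop_oversize ?sl' // /star_prod big_nil.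
- rewrite subnn drop0 /l' [RHS]lP /star_prod big_cat /= big_nseq.
  by rewrite tperm1; elim: (n - _)%N => [|m IH]; rewrite ?mul1g //= mul1g.
- move=> j jn; exists (nth h l' (n - j.+1)%N).
  rewrite (@drop_nth _ h (n - j.+1)%N) ?sl'; last by lia.
  rewrite /star_prod big_cons; congr (_ * \prod_(p <- drop _ _) _); lia.
Qed.

End StarTranspositions.

Section Orientation.
Variable K : nat.
Local Open Scope ring_scope.
Import GRing.Theory.
Notation Z := 'I_K.+3.
Implicit Types (f g : Z -> Z) (a b : Z).

(** One bit of the cyclic orientation: the comparison of the two colours flanking colour [ord0]. *)
Definition orientation f :=
  [exists a, (f a == ord0) && (f (a + 1)%R < f (a - 1)%R)%N].

Definition layers_proper f g :=
  forall a b, a + b <> 0 -> a + b <> 1 -> f a <> g b.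

(* If [a] keeps its colour at [- a], then [a + 1] cannot use [- a], and so keeps
   its colour at [- (a + 1)]; going around the cycle, [d = 0] throughout. *)
Lemma layer_reflection f g : injective f -> injective g -> layers_proper f g ->
  exists d, forall a, g (d - a) = f a.
Proof.
move=> fI gI fg.
have step a : g (- a) = f a \/ g (1 - a) = f a.
  pose b := invF gI (f a).
  have gb : g b = f a by rewrite f_invF.
  have [ab0|ab0] := eqVneq (a + b) 0.
    by left; rewrite -gb -(addKr a b) ab0 addr0.
  have [ab1|ab1] := eqVneq (a + b) 1.
    by right; rewrite -gb -(addKr a b) ab1 addrC.
  by case: (fg a b (elimN eqP ab0) (elimN eqP ab1)).
have [[a ga]|nz] := pselect (exists a, g (- a) = f a); last first.
  by exists 1 => a; case: (step a) => // ga; case: nz; exists a.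
exists 0 => b; rewrite sub0r.
have {}ga n : g (- (a + n%:R)) = f (a + n%:R).
  elim: n => [|n IH]; first by rewrite addr0.
  case: (step (a + n.+1%:R)) => //.
  rewrite (_ : 1 - (a + n.+1%:R) = - (a + n%:R)); last by rewrite -natr1; ring.
  rewrite IH => /fI/addrI; rewrite -natr1 => /eqP.
  by rewrite addrC -subr_eq subrr eq_sym oner_eq0.
have := ga (val (b - a)); rewrite natr_Zp addrC subrK //.
Qed.

(** The reflection matches the vertices coloured [ord0] and exchanges their two neighbours. *)
Lemma orientation_flip f g : injective f -> injective g -> layers_proper f g ->
  orientation g = ~~ orientation f.
Proof.
move=> fI gI fg; have [d gf] := layer_reflection fI gI fg.
pose a := invF fI ord0; have fa : f a = ord0 by rewrite f_invF.
have uniq_at (F : Z -> Z) c : injective F -> F c = ord0 ->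
    orientation F = (F (c + 1)%R < F (c - 1)%R)%N.
  move=> FI Fc; apply/existsP/idP => [[x /andP[/eqP Fx]]|Flt].
    by rewrite (FI x c) // Fx.
  by exists c; rewrite Fc eqxx.
rewrite (uniq_at f a) // (uniq_at g (d - a)) ?gf //.
have -> : d - a + 1 = d - (a - 1) by ring.
have -> : d - a - 1 = d - (a + 1) by ring.
(* In a cycle of length at least 3, [a - 1] and [a + 1] differ, so the negated comparison is again
   strict. *)
rewrite !gf -leqNgt ltn_neqAle; case: eqVneq => //= /val_inj/fI/addrI/eqP.
rewrite eq_sym -subr_eq0 opprK => /eqP/(congr1 val) /=.
by rewrite /= !modn_small.
Qed.

End Orientation.

(** * Lower bound *)

Section DeltaShift.
Variable K : nat.
Local Open Scope ring_scope.
Import Order.TTheory GRing.Theory Num.Theory.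
Notation Z := 'Z_K.+3.
Notation D := (Delta K.+3).
Notation X := (set_type (@free_part D)).
Notation gens := (@Delta_gens K.+3).

Lemma Delta_enum : exists e : nat -> D, forall g, exists n, e n = g.
Proof.
exists (fun n => odflt (0, 0) (unpickle n : option (Z * int))) => g.
by exists (pickle (g : Z * int)); rewrite pickleK.
Qed.

Lemma layer_bound (s : seq D) :
  exists B : nat, forall h, h \in s -> `|h.2| <= B%:Z.
Proof.
elim: s => [|g s [B sB]]; first by exists 0%N.
exists (B + `|g.2|%N)%N => h; rewrite inE => /orP[/eqP ->|/sB]; lia.
Qed.

Lemma Delta_infinite (s : seq D) : exists g, g \notin s.
Proof.
have [B sB] := layer_bound s; exists ((0, B.+1%:Z) : D).
by apply/negP => /sB /=; lia.
Qed.

Definition odd_translations : set D :=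
  [set g | exists2 n, odd n & g = (0, n%:Z)].

Lemma Delta_displace (s : seq D) :
  exists2 g, odd_translations g & forall h, h \in s -> (g * h)%g \notin s.
Proof.
(* The layers of [s] lie between [- B] and [B]; a shift by [2B + 1] leaves this range, and it is
   odd. *)
have [B sB] := layer_bound s; exists ((0, B.*2.+1%:Z) : D).
  by exists B.*2.+1 => //=; rewrite odd_double.
move=> h /sB hB; apply/negP => /sB.
rewrite -[(_ * h)%g]/(Delta_mul _ h) /Delta_mul /=; lia.
Qed.

Lemma actE (a b : Z) (m n : int) (x : X) :
  act ((a, m) : D) (act ((b, n) : D) x) = act ((a + (-1) ^ m * b, m + n) : D) x.
Proof. by rewrite -actM. Qed.

Lemma gens_not1 : ~ gens 1%g.
Proof. by case: (@Delta_marking K.+3 isT). Qed.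

Lemma not_borel_colorable : ~ borel_colorable (shift_graph gens) K.+3.
Proof.
move=> [c [cB cP]]; have [e e_surj] := Delta_enum.
have /choice[U UP] : forall i, exists U, cyl_open U /\ residual
    [set x | forall z : X, set_val z = x -> (c z = i <-> U x)].
  move=> i; have [U oU rU] := borel_baire_property (cB [set i]).
  by exists U.
(* At every point of a generic orbit, membership in a colour class coincides with membership in the
   open set [U i]. *)
have rU := residual_forall (fun n => residual_act (e n)
  (residual_forall (fun i => (UP i).2))).
have rR := residual_recurrent e_surj Delta_displace.
have rF := residual_free_part e_surj Delta_infinite.
have [x xP] : exists x, [/\ forall g i (z : X), set_val z = shift_act g x ->
      (c z = i <-> U i (shift_act g x)),
    forall s, exists2 g, odd_translations g & agree s x (shift_act g x) &
    free_part x].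
  have /residual_nonempty[x xP] := residual_forall (fun b : bool =>
    if b return residual (if b then _ else _) then rU else
    residual_forall (fun b : bool =>
      if b return residual (if b then _ else _) then rR else rF)).
  exists x; split; last by have := xP false false.
    by move=> g i z; have [n <-] := e_surj g; exact: (xP true n i).
  exact: (xP false true).
have {xP} [xU xR xF] := xP.
pose z : X := SigSub (mem_set xF).
pose phi (m : nat) (a : Z) := c (act ((a, m%:Z) : D) z).
have phiI m : injective (phi m).
  move=> a b; apply: contraPP => ab.
  rewrite /phi (_ : act ((b, m%:Z) : D) z =
      act ((b - a, 0) : D) (act ((a, m%:Z) : D) z)); last first.
    by rewrite actE expr0z mul1r subrK add0r.
  apply: cP; apply: act_shift_graph; first exact: gens_not1.
  by constructor 1; split=> //= /eqP; rewrite subr_eq0 => /eqP/esym.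
have phiP m : layers_proper (phi m) (phi m.+1).
  move=> a b ab0 ab1; rewrite /phi.
  rewrite (_ : act ((b, m.+1%:Z) : D) z =
      act ((a + b, 1) : D) (act ((a, m%:Z) : D) z)); last first.
    by rewrite actE expr1z mulN1r (addrC a) addrK intS.
  apply: cP; apply: act_shift_graph; first exact: gens_not1.
  by constructor 2.
have orient m : orientation (phi m) = odd m (+) orientation (phi 0%N).
  elim: m => // m IH.
  by rewrite (orientation_flip (phiI m) (phiI m.+1)) // IH /= addNb.
(* The open conditions recording the colours of layer [0] depend on finitely many coordinates of the
   base point. *)
have /choice[s sP] : forall a : Z, exists s : seq D, forall y,
    agree s x y -> U (phi 0%N a) (shift_act ((a, 0) : D) y).
  move=> a; have Ua : U (phi 0%N a) (shift_act ((a, 0) : D) x).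
    by apply/(xU _ _ (act ((a, 0) : D) z)).
  have [t tU] := (UP (phi 0%N a)).1 _ Ua.
  exists [seq (((a, 0) : D)^-1 * h)%g | h <- t] => y xy.
  by apply: tU => h ht; apply: xy; exact: map_f.
(* Recurrence on all these coordinates makes some odd layer [n] repeat the colours of layer [0],
   against [orient]. *)
have [_ [n n_odd ->] nx] := xR (flatten [seq s a | a <- enum 'I_K.+3]).
have := orient n; rewrite n_odd /= (_ : phi n = phi 0%N).
  by case: orientation.
apply/funext => a; apply/(xU ((a, n%:Z) : D)) => //.
rewrite (_ : ((a, n%:Z) : D) = (((a, 0) : D) * ((0, n%:Z) : D))%g); last first.
  rewrite -[(_ * _)%g]/(Delta_mul _ _) /Delta_mul /=.
  by rewrite mulr0 addr0 add0r.
rewrite shift_actM; apply: sP => h hs; apply: nx.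
by apply/flattenP; exists (s a) => //; rewrite map_f // mem_enum.
Qed.

End DeltaShift.

(** * Upper bound *)

Section UpperBound.
Variable K : nat.
Local Open Scope ring_scope.
Import Order.TTheory GRing.Theory Num.Theory.
Notation Z := 'Z_K.+3.
Notation D := (Delta K.+3).
Notation X := (set_type (@free_part D)).
Notation gens := (@Delta_gens K.+3).

Lemma sign_expzN (i : nat) : (-1 : Z) ^ (- i%:Z) = (-1) ^+ i.
Proof. by rewrite -exprnN -exprVn invrN1. Qed.

Lemma sign_addI (i : nat) (a b : Z) : a + (-1) ^+ i * b = a -> b = 0.
Proof.
move=> /(canRL (addKr a)); rewrite addNr => /(congr1 ( *%R ((-1) ^+ i))).
by rewrite signrMK mulr0.
Qed.

Lemma closing_map_inj (n : nat) (b : Z) :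
  injective (omap (fun a : Z => (-1) ^+ n * a - b)).
Proof.
have inj_ab : injective (fun a : Z => (-1) ^+ n * a - b).
  move=> a a' /= /addIr /(congr1 ( *%R ((-1) ^+ n))).
  by rewrite !signrMK.
exact: inj_omap.
Qed.

(* Reads the colour [Some a'] that the marker [act (b, n) x] gives to
   [chart x n a]; the point [None] holds the unused colour. *)
Definition closing_perm (n : nat) (b : Z) : {perm option Z} :=
  perm (@closing_map_inj n b).

Definition option_color (o : option Z) : 'I_K.+4 :=
  if o is Some a then lift ord_max a else ord_max.

Lemma option_color_inj : injective option_color.
Proof.
case=> [a|] [b|] //=; first by move=> /lift_inj ->.
  by move=> /eqP; rewrite eq_sym (negPf (neq_lift _ _)).
by move=> /eqP; rewrite (negPf (neq_lift _ _)).
Qed.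

Definition window (N : nat) : seq D :=
  [seq ((a, i%:Z - N%:Z) : Z * int) | a <- enum 'I_K.+3, i <- iota 0 (N.*2 + 1)].

Lemma mem_window N (g : D) : (g \in window N) = (`|g.2| <= N%:Z).
Proof.
case: g => a m; apply/allpairsP/idP => /= [[[b i] [_]]|mN].
  by rewrite /= mem_iota => iN [_ ->]; lia.
exists (a, absz (m + N%:Z)); split; rewrite ?mem_enum //=.
  by rewrite mem_iota; lia.
by congr (_, _); lia.
Qed.

(** * Segments between consecutive markers *)

Variables (N : nat) (M : X -> Prop).
Hypothesis M_borel : forall g, borel_set [set x | M (act g x)].
Hypothesis M_sparse : forall x (g : D),
  `|g.2| <= N%:Z -> M x -> M (act g x) -> g = 1%g.
Hypothesis M_syndetic : forall x, exists2 g : D, `|g.2| <= N%:Z & M (act g x).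

(* Equals [act (0, j) (act (a, 0) x)]: in these coordinates the vertices with
   the same [a] in consecutive layers are not adjacent. *)
Definition chart (x : X) (j : nat) (a : Z) : X :=
  act (((-1) ^+ j * a, j%:Z) : D) x.

Definition next_marker (x : X) (n : nat) (b : Z) :=
  (0 < n)%N /\ M (act ((b, n%:Z) : D) x) /\
  forall (i : nat) (d : Z), (0 < i < n)%N -> ~ M (act ((d, i%:Z) : D) x).

(* [z = chart x j a], where [x] is the last marker in or before the layer of
   [z], and the next marker is [act (b, n) x]. *)
Definition segment (z : X) (j : nat) (a : Z) (n : nat) (b : Z) :=
  let x := act ((- a, - j%:Z) : D) z in
  M x /\ (forall (i : nat) (d : Z), (i < j)%N -> ~ M (act ((d, - i%:Z) : D) z)) /\
  next_marker x n b.

Lemma M_layer_uniq z (b d : Z) (m : int) :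
  M (act ((b, m) : D) z) -> M (act ((d, m) : D) z) -> b = d.
Proof.
move=> Mb Md.
have := @M_sparse (act ((b, m) : D) z) ((d - b, 0) : D).
rewrite actE expr0z mul1r subrK add0r /= normr0 => /(_ isT Mb Md).
by move=> /(congr1 fst) /eqP; rewrite subr_eq0 => /eqP.
Qed.

(** Makes every gap long enough for the paths of [N_path], whose threshold is the same [N]. *)
Lemma next_marker_gap x n b : M x -> next_marker x n b -> (N < n)%N.
Proof.
move=> Mx [n0 [Mn _]]; rewrite ltnNge; apply/negP => nN.
by have /(_ nN Mx Mn)/(congr1 snd) [] := @M_sparse x ((b, n%:Z) : D); lia.
Qed.

Lemma next_marker_uniq x n b n' b' :
  next_marker x n b -> next_marker x n' b' -> n = n' /\ b = b'.
Proof.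
move=> [n0 [Mn Ln]] [n0' [Mn' Ln']].
have e : n = n'.
  have [nn|nn|//] := ltngtP n n'; first by case: (Ln' n b); rewrite ?n0.
  by case: (Ln n' b'); rewrite ?n0'.
by subst n'; split=> //; exact: M_layer_uniq Mn Mn'.
Qed.

Lemma segment_uniq z j a n b j' a' n' b' :
  segment z j a n b -> segment z j' a' n' b' ->
  [/\ j = j', a = a', n = n' & b = b'].
Proof.
move=> [Mx [Lj nx]] [Mx' [Lj' nx']].
have e : j = j'.
  have [jj|jj|//] := ltngtP j j'; first by case: (Lj' j (- a)).
  by case: (Lj j' (- a')).
subst j'; have /oppr_inj e := M_layer_uniq Mx Mx'.
by subst a'; have [-> ->] := next_marker_uniq nx nx'.
Qed.

Lemma next_marker_exists x : exists n b, next_marker x n b.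
Proof.
(* Searching around layer [N + 1] finds a marker in a layer from [1] to [2N + 1], hence strictly
   after [x]. *)
have [[a m] /= mN Mm] := M_syndetic (act ((0, N.+1%:Z) : D) x).
move: Mm; rewrite actE mulr0 addr0.
have [i ->] : exists i : nat, m + N.+1%:Z = i.+1%:Z.
  by exists (absz (m + N%:Z)); lia.
move=> Mi; pose P n := `[< (0 < n)%N /\ exists b, M (act ((b, n%:Z) : D) x) >].
have exP : exists n, P n by exists i.+1; apply/asboolP; split=> //; exists a.
case: (ex_minnP exP) => n /asboolP[n0 [b Mb]] min_n.
exists n, b; split=> //; split=> // j d /andP[j0 jn] Mj.
suff : (n <= j)%N by rewrite leqNgt jn.
by apply: min_n; apply/asboolP; split=> //; exists d.
Qed.

Lemma segment_exists z : exists j a n b, segment z j a n b.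
Proof.
(* Searching around layer [- N] finds a marker in or before the layer of [z]. *)
have [[a m] /= mN Mm] := M_syndetic (act ((0, - N%:Z) : D) z).
move: Mm; rewrite actE mulr0 addr0.
have [i ->] : exists i : nat, m - N%:Z = - i%:Z.
  by exists (absz (m - N%:Z)); lia.
move=> Mi; pose P n := `[< exists b, M (act ((b, - n%:Z) : D) z) >].
have exP : exists n, P n by exists i; apply/asboolP; exists a.
case: (ex_minnP exP) => j /asboolP[b Mb] min_j.
have [n [d nx]] := next_marker_exists (act ((b, - j%:Z) : D) z).
exists j, (- b), n, d; rewrite /segment opprK; split=> //; split=> // l f lj Ml.
suff : (j <= l)%N by rewrite leqNgt lj.
by apply: min_j; apply/asboolP; exists f.
Qed.

Lemma chartK x j a : act ((- a, - j%:Z) : D) (chart x j a) = x.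
Proof.
rewrite /chart actE sign_expzN signrMK !addNr.
exact: (@act1 _ x).
Qed.

Lemma chart_base z j a : chart (act ((- a, - j%:Z) : D) z) j a = z.
Proof.
rewrite /chart actE -exprnP mulrN !subrr.
exact: (@act1 _ z).
Qed.

Lemma segment_chart x n b j a : M x -> next_marker x n b -> (j < n)%N ->
  segment (chart x j a) j a n b.
Proof.
move=> Mx nx jn; rewrite /segment chartK; split=> //; split=> // i d ij.
rewrite /chart actE (_ : - i%:Z + j%:Z = (j - i)%N%:Z); last by lia.
by apply: nx.2.2; lia.
Qed.

(** Otherwise the next marker would lie in or before the layer of [z] but after the last marker
    there. *)
Lemma segment_step z j a n b : segment z j a n b -> (j < n)%N.
Proof.
move=> [Mx [Lj [n0 [Mn _]]]]; rewrite ltnNge; apply/negP => nj.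
move: Mn; rewrite actE (_ : n%:Z - j%:Z = - (j - n)%N%:Z); last by lia.
by apply: Lj; lia.
Qed.

Lemma borel_segment j a n b : borel_set [set z | segment z j a n b].
Proof.
have bM2 (g h : D) : borel_set [set z | M (act g (act h z))].
  by under eq_fun do rewrite -actM; exact: M_borel.
apply: borel_and; first exact: M_borel.
apply: borel_and.
  apply: borel_forall => i; apply: borel_forall => d.
  by apply: borel_imply; apply: borel_not; exact: M_borel.
apply: borel_and; first exact: borel_cst.
apply: borel_and; first exact: bM2.
apply: borel_forall => i; apply: borel_forall => d.
by apply: borel_imply; apply: borel_not; exact: bM2.
Qed.

Hypothesis N_path : forall n (s : {perm option Z}), (N <= n)%N ->
  exists st : nat -> {perm option Z}, [/\ st 0%N = 1%g, st n = s &
    forall j, (j < n)%N -> exists p, st j.+1 = (tperm None p * st j)%g].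

Lemma markers_borel_colorable : borel_colorable (shift_graph gens) K.+4.
Proof.
(* For each gap length and position of the next marker, one path of star moves from the identity to
   the closing permutation is fixed. Below [N] the constant path is a default value. *)
have /choice[st stP] : forall q : nat * Z, exists st : nat -> {perm option Z},
    (N <= q.1)%N -> [/\ st 0%N = 1%g, st q.1 = closing_perm q.1 q.2 &
    forall j, (j < q.1)%N -> exists p, st j.+1 = (tperm None p * st j)%g].
  move=> [n b] /=; have [/N_path - /(_ (closing_perm n b))[st H]|nN] := leqP N n.
    by exists st.
  by exists (fun=> 1%g).
pose col j a n b := option_color (st (n, b) j (Some a)).
have /choice[c cP] : forall z, exists i, exists j a n b,
    segment z j a n b /\ i = col j a n b.
  move=> z; have [j [a [n [b zs]]]] := segment_exists z.
  by exists (col j a n b), j, a, n, b.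
have cE z j a n b : segment z j a n b -> c z = col j a n b.
  move=> zs; have [j' [a' [n' [b' [zs' ->]]]]] := cP z.
  by have [-> -> -> ->] := segment_uniq zs zs'.
(* The case [j = n] is the gluing: the closing permutation is the change of coordinates from [x] to
   the next marker [y], whose own path starts at the identity. Two consecutive layers can thus be
   compared within one segment. *)
have c_chart x n b j a : M x -> next_marker x n b -> (j <= n)%N ->
    c (chart x j a) = col j a n b.
  move=> Mx nx; rewrite leq_eqVlt => /predU1P[->|jn]; last first.
    exact/cE/segment_chart.
  have Mn := nx.2.1; set y := act _ x in Mn.
  have [n' [b' ny]] := next_marker_exists y.
  have -> : chart x n a = chart y 0 ((-1) ^+ n * a - b).
    by rewrite /chart actE !mul1r subrK add0r.
  rewrite (cE _ _ _ _ _ (segment_chart _ Mn ny _)); last by case: ny.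
  have [st0 _ _] := stP (n', b') (ltnW (next_marker_gap Mn ny)).
  have [_ stn _] := stP (n, b) (ltnW (next_marker_gap Mx nx)).
  by rewrite /col st0 stn perm1 permE.
have c_layer z (i : Z) : i <> 0 -> c (act ((i, 0) : D) z) <> c z.
  move=> i0; have [j [a [n [b zs]]]] := segment_exists z.
  have jn := segment_step zs; have [Mx [_ nx]] := zs.
  rewrite -(chart_base z j a); set x := act ((- a, _) : D) z in Mx nx *.
  have -> : act ((i, 0) : D) (chart x j a) = chart x j (a + (-1) ^+ j * i).
    by rewrite /chart actE expr0z mul1r add0r mulrDr signrMK addrC.
  rewrite !(c_chart _ n b) ?(ltnW jn) // => /option_color_inj/perm_inj[].
  by move=> /sign_addI.
have c_step z (i : Z) : i <> 0 -> c (act ((i, 1) : D) z) <> c z.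
  move=> i0; have [j [a [n [b zs]]]] := segment_exists z.
  have jn := segment_step zs; have [Mx [_ nx]] := zs.
  rewrite -(chart_base z j a); set x := act ((- a, _) : D) z in Mx nx *.
  have -> : act ((i, 1) : D) (chart x j a) = chart x j.+1 (a + (-1) ^+ j.+1 * i).
    rewrite /chart actE expr1z mulN1r mulrDr signrMK exprS mulN1r mulNr.
    by rewrite intS addrC.
  rewrite !(c_chart _ n b) ?(ltnW jn) // => /option_color_inj.
  have [_ _ /(_ j jn)[p ->]] := stP (n, b) (ltnW (next_marker_gap Mx nx)).
  rewrite permM => /perm_inj.
  by case: tpermP => // _ _ [] /sign_addI.
exists c; split.
- move=> B; rewrite (_ : c @^-1` B = [set z | exists q : nat * Z * nat * Z,
    segment z q.1.1.1 q.1.1.2 q.1.2 q.2 /\ B (col q.1.1.1 q.1.1.2 q.1.2 q.2)]).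
    apply: borel_exists => q; apply: borel_and; first exact: borel_segment.
    exact: borel_cst.
  apply/seteqP; split=> z /=; last by move=> [q [/cE ->]].
  have [j [a [n [b [zs ->]]]]] := cP z => Bc.
  by exists (j, a, n, b).
- move=> x y /shift_graph_act[[i m] /= s ->].
  case: s => /= [[i0 ->]|[i0 _ ->]|[i0 _ ->]]; apply/nesym.
  + exact: c_layer.
  + exact: c_step.
  (* [(i, -1)] is the inverse of [(i, 1)], so the edge is read from its other end. *)
  + apply/nesym; have := @c_step (act ((i, -1) : D) x) i i0.
    rewrite actE expr1z mulN1r !subrr.
    by rewrite (_ : act _ x = x) //; exact: (@act1 _ x).
Qed.

End UpperBound.

(** The path threshold [N] is fixed first; the markers are then a Borel maximal independent set for
    the window of layers within [N]. *)
Lemma Delta_borel_colorable K :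
  borel_colorable (shift_graph (@Delta_gens K.+3)) K.+4.
Proof.
have [N NP] := star_path (None : option 'Z_K.+3).
have [e e_surj] := Delta_enum K.
have [||M [M1 M2 M3]] := @borel_maximal_independent _ e (window K N) e_surj.
- by rewrite mem_window.
- move=> g; rewrite !mem_window -[(g^-1)%g]/(Delta_inv g) /=.
  by rewrite Num.Theory.normrN.
apply: (@markers_borel_colorable K N M) => //.
- by move=> x g gN; apply: M2; rewrite mem_window.
- by move=> x; have [g] := M3 x; rewrite mem_window; exists g.
Qed.

Lemma borel_colorable_leq (T : topologicalType) (E : T -> T -> Prop) m n :
  (m <= n)%N -> borel_colorable E m -> borel_colorable E n.
Proof.
move=> mn [c [cB cP]]; exists (widen_ord mn \o c); split.
  by move=> B; rewrite comp_preimage; exact: cB.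
by move=> x y /cP + /(congr1 val) /= e; apply; exact: val_inj.
Qed.

Theorem theorem5 (k : nat) (k_ge3 : (3 <= k)%N) :
  is_borel_chromatic_number (shift_graph (@Delta_gens k)) k.+1.
Proof.
case: k k_ge3 => [|[|[|K]]] // _; split; first exact: Delta_borel_colorable.
move=> m cm; rewrite ltnNge; apply/negP => mk.
exact: not_borel_colorable (borel_colorable_leq mk cm).
Qed.
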